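(* Let $X\in\mathbb{R}^{n\times d}$, $n>d$, have rank $d$, with rows $x_1^\top,\dots,x_n^\top$ ordered so that the leverage scores satisfy $\ell_1(X)\ge\dots\ge\ell_n(X)$, and let $\varepsilon\in(0,1)$. Let $s$ be the smallest $j\in\{1,\dots,n\}$ such that $\sum_{i=1}^j \ell_i(X)>d-\varepsilon$, and let $X_s\in\mathbb{R}^{s\times d}$ be the matrix consisting of the first $s$ rows of $X$. Let $u_0=\frac1s e=(\frac1s,\dots,\frac1s)^\top\in\mathbb{R}^s$. Then $$g^*-g_s(u_0)<d\log\left(\frac{s}{1-\varepsilon}\right).$$
   Context: For $X\in\mathbb{R}^{n\times d}$ of rank $d$, the $i$th leverage score is $\ell_i(X)=e_i^\top X(X^\top X)^{-1}X^\top e_i$, where $e_i$ is the $i$th standard basis vector; one has $\sum_{i=1}^n\ell_i(X)=d$. The vector $e$ is the all-ones vector. The dual (D-optimal design) form of the centred minimum volume covering ellipsoid problem for the points $x_1,\dots,x_n$ is to maximise $g(u)=\log\det\left(\sum_{i=1}^n u_i x_i x_i^\top\right)$ over $u\in\mathbb{R}^n$ with $u\ge 0$ and $\sum_{i=1}^n u_i=1$; $g^*$ denotes its optimal value. For the sampled points, $g_s(u)=\log\det\left(X_s^\top \mathrm{diag}(u)X_s\right)$ for $u\in\mathbb{R}^s$ with $u\ge0$ and $\sum_{i=1}^s u_i=1$. *)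

(* Defs.v *)
(* MathComp / MathComp-Analysis *)
From HB Require Import structures.
From mathcomp Require Import all_boot all_order all_algebra.
From mathcomp Require Import all_classical all_reals all_analysis.

Set Implicit Arguments.
Unset Strict Implicit.
Unset Printing Implicit Defensive.

Import Order.TTheory GRing.Theory Num.Theory.
Local Open Scope classical_set_scope.
Local Open Scope ring_scope.

(* The rows of X are x_1^T, ..., x_n^T, indexed from 0 here. *)

Definition leverage (R : realType) (n d : nat) (X : 'M[R]_(n, d)) (i : 'I_n) : R :=
  let e_i : 'cV[R]_n := delta_mx i 0 in
  (e_i^T *m X *m invmx (X^T *m X) *m X^T *m e_i) 0 0.

Definition leverage_sum (R : realType) (n d : nat) (X : 'M[R]_(n, d)) (j : nat) : R :=
  \sum_(i < n | (i < j)%N) leverage X i.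

Definition simplex (R : realType) (n : nat) : set 'cV[R]_n :=
  [set u | (forall i, 0 <= u i 0) /\ \sum_i u i 0 = 1].

(* The objectives take values in \bar R because the real-valued [ln] is 0 at 0,
   whereas log det must be -oo at singular matrices; [lne 0 = -oo]. *)
Definition dual_objective (R : realType) (n d : nat) (X : 'M[R]_(n, d))
    (u : 'cV[R]_n) : \bar R :=
  lne (\det (\sum_i u i 0 *: ((row i X)^T *m row i X)))%:E.

Definition dual_optimum (R : realType) (n d : nat) (X : 'M[R]_(n, d)) : \bar R :=
  ereal_sup (dual_objective X @` @simplex R n).

Definition first_rows (R : realType) (n d s : nat) (hs : (s <= n)%N)
    (X : 'M[R]_(n, d)) : 'M[R]_(s, d) :=
  rowsub (widen_ord hs) X.

Definition sampled_objective (R : realType) (s d : nat) (Xs : 'M[R]_(s, d))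
    (u : 'cV[R]_s) : \bar R :=
  lne (\det (Xs^T *m diag_mx u^T *m Xs))%:E.

Definition is_threshold (R : realType) (n d : nat) (X : 'M[R]_(n, d))
    (eps : R) (s : nat) : Prop :=
  [/\ (1 <= s <= n)%N,
      d%:R - eps < leverage_sum X s
    & forall j : nat, (1 <= j <= n)%N -> d%:R - eps < leverage_sum X j -> (s <= j)%N].

(* Main.v *)
(** Symmetrising the Cauchy-Binet expansion gives
      d! * det (X^T diag(w) X) = sum_f (prod_k w_(f k)) * det (X_f)^2,
    over all maps f from [d] to [n], where X_f has rows x_(f 1), ..., x_(f d).
    The right-hand side is nondecreasing in w >= 0, and weights of the simplex
    are at most 1, so g* <= log det (X^T X).  For 0/1 weights, a union bound over
    the rows missed by the sample gives
      det (X^T X) - det (X_s^T X_s)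
        <= sum_(i > s) (det (X^T X) - det (X^T X - x_i x_i^T))
        = det (X^T X) * sum_(i > s) l_i(X) < eps * det (X^T X),
    so log det (X_s^T X_s) > log det (X^T X) + log (1 - eps). *)
Require Import Defs.
From HB Require Import structures.
From mathcomp Require Import all_boot all_order all_algebra.
From mathcomp Require Import perm.
From mathcomp Require Import all_classical all_reals all_analysis.

Set Implicit Arguments.
Unset Strict Implicit.
Unset Printing Implicit Defensive.

Import Order.TTheory GRing.Theory Num.Theory.
Local Open Scope ring_scope.

Definition weighted_gram (R : comPzRingType) (n d : nat) (X : 'M[R]_(n, d))
    (w : 'rV[R]_n) : 'M[R]_d :=
  X^T *m diag_mx w *m X.

Lemma weighted_gramE (R : comPzRingType) (n d : nat) (X : 'M[R]_(n, d))
    (w : 'rV[R]_n) :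
  weighted_gram X w = \sum_i w 0 i *: ((row i X)^T *m row i X).
Proof.
apply/matrixP=> a b; rewrite /weighted_gram -mulmxA mul_diag_mx !mxE summxE.
apply: eq_bigr => i _; rewrite !mxE big_ord1 !mxE.
by rewrite mulrCA.
Qed.

(** In the Leibniz expansion, multiplying out the product of entry sums selects one row index [f k]
    for each [k]; the signed sum over permutations then reassembles into a minor. Non-injective [f]
    may stay, since a repeated row makes that minor vanish. *)
Lemma det_tr_mul (R : comPzRingType) (n d : nat) (Y X : 'M[R]_(n, d)) :
  \det (Y^T *m X) =
    \sum_(f : {ffun 'I_d -> 'I_n}) (\prod_k Y (f k) k) * \det (rowsub f X).
Proof.
rewrite /determinant.
under eq_bigr => s _.
  under eq_bigr => k _ do rewrite mxE.
  rewrite bigA_distr_bigA mulr_sumr.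
  over.
rewrite exchange_big; apply: eq_bigr => f _; rewrite mulr_sumr.
apply: eq_bigr => s _; rewrite mulrCA -big_split; congr (_ * _).
by apply: eq_bigr => k _; rewrite !mxE.
Qed.

(** Replacing [f] by its composite with a permutation [s] fixes the weight product and multiplies
    the minor by the sign of [s]. Summing over all [d!] permutations turns the product of entries
    into a second copy of the minor. *)
Lemma det_weighted_gram (R : comPzRingType) (n d : nat) (X : 'M[R]_(n, d))
    (w : 'rV[R]_n) :
  \det (weighted_gram X w) *+ d`! =
    \sum_(f : {ffun 'I_d -> 'I_n}) (\prod_k w 0 (f k)) * \det (rowsub f X) ^+ 2.
Proof.
pose P (f : 'I_d -> 'I_n) := \prod_k w 0 (f k); pose D f := \det (rowsub f X).
have expand : \det (weighted_gram X w) =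
    \sum_(f : {ffun 'I_d -> 'I_n}) P f * (\prod_k X (f k) k) * D f.
  have -> : weighted_gram X w = (diag_mx w *m X)^T *m X.
    by rewrite /weighted_gram trmx_mul tr_diag_mx.
  rewrite det_tr_mul; apply: eq_bigr => f _; rewrite -big_split /=.
  by congr (_ * _); apply: eq_bigr => k _; rewrite mul_diag_mx mxE.
have permuted (s : 'S_d) : \det (weighted_gram X w) =
    \sum_(f : {ffun 'I_d -> 'I_n})
      P f * ((-1) ^+ s * \prod_k X (f (s k)) k) * D f.
  pose h (t : 'S_d) (f : {ffun 'I_d -> 'I_n}) := [ffun k => f (t k)].
  rewrite expand (reindex (h s)); last first.
    by exists (h s^-1%g) => f _; apply/ffunP => k; rewrite !ffunE ?permK ?permKV.
  apply: eq_bigr => f _.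
  have -> : P (h s f) = P f.
    rewrite /P [RHS](reindex_inj (@perm_inj _ s)) /=.
    by apply: eq_bigr => k _; rewrite ffunE.
  have -> : D (h s f) = (-1) ^+ s * D f.
    rewrite /D -det_perm -det_mulmx -row_permE; congr (\det _).
    by apply/matrixP => i j; rewrite !mxE ffunE.
  under eq_bigr => k _ do rewrite ffunE.
  by rewrite !mulrA; congr (_ * _); rewrite -!mulrA; congr (_ * _); rewrite mulrC.
rewrite -card_Sn -sumr_const (eq_bigr _ (fun s _ => permuted s)) exchange_big.
apply: eq_bigr => f _; rewrite -mulr_suml -mulr_sumr -mulrA; congr (_ * _).
rewrite expr2; congr (_ * _); rewrite -/(D f) /D -det_tr.
by apply: eq_bigr => s _; congr (_ * _); apply: eq_bigr => k _; rewrite !mxE.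
Qed.

Lemma det_gram_gt0 (R : realFieldType) (n d : nat) (X : 'M[R]_(n, d)) :
  \rank X = d -> 0 < \det (weighted_gram X (const_mx 1)).
Proof.
move=> rankX; have fullX : row_full X by apply/eqP.
rewrite -(pmulrn_lgt0 _ (fact_gt0 d)) det_weighted_gram.
(* [f0] picks [d] independent rows, so its squared minor is a strictly positive term among
   nonnegative ones. *)
pose f0 : {ffun 'I_d -> 'I_n} := fullrankfun fullX.
rewrite (bigD1 f0) //= ltr_pwDl //.
  rewrite big1 ?mul1r; last by move=> k _; rewrite mxE.
  rewrite lt_def sqr_ge0 sqrf_eq0 andbT -unitfE -unitmxE.
  exact: fullrowsub_unit.
apply: sumr_ge0 => f _; rewrite mulr_ge0 ?sqr_ge0 //.
by apply: prodr_ge0 => k _; rewrite mxE.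
Qed.

Lemma det_weighted_gram_le (R : realDomainType) (n d : nat) (X : 'M[R]_(n, d))
    (v w : 'rV[R]_n) :
  (forall i, 0 <= v 0 i <= w 0 i) ->
  \det (weighted_gram X v) <= \det (weighted_gram X w).
Proof.
move=> le_vw; rewrite -(ler_pMn2r (fact_gt0 d)) !det_weighted_gram.
apply: ler_sum => f _; rewrite ler_wpM2r ?sqr_ge0 //.
by apply: ler_prod.
Qed.

(** Deleting rows is encoded as giving them weight 0, so that all the Gram determinants expand over
    the same maps [f]. *)
Definition indicator_row (R : pzSemiRingType) (n : nat) (A : pred 'I_n) : 'rV[R]_n :=
  \row_i (A i)%:R.

Lemma det_gram_union_bound (R : realDomainType) (n d : nat) (X : 'M[R]_(n, d))
    (A : pred 'I_n) :
  \det (weighted_gram X (const_mx 1))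
    - \det (weighted_gram X (indicator_row R A)) <=
  \sum_(i | ~~ A i) (\det (weighted_gram X (const_mx 1))
    - \det (weighted_gram X (indicator_row R (predC1 i)))).
Proof.
have prod_ind (B : pred 'I_n) (f : {ffun 'I_d -> 'I_n}) :
    \prod_k indicator_row R B 0 (f k) = [forall k, B (f k)]%:R.
  case: forallP => [Bf|/forallP]; first by rewrite big1 // => k _; rewrite mxE Bf.
  rewrite negb_forall => /existsP[k /negPf nBfk].
  by rewrite (bigD1 k) //= mxE nBfk mul0r.
have prod1 (f : {ffun 'I_d -> 'I_n}) : \prod_k (const_mx 1 : 'rV[R]_n) 0 (f k) = 1.
  by rewrite big1 // => k _; rewrite mxE.
(* The deficit caused by keeping only [B] comes exactly from the maps whose image leaves [B]. *)
have detB (B : pred 'I_n) : (\det (weighted_gram X (const_mx 1))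
    - \det (weighted_gram X (indicator_row R B))) *+ d`! =
    \sum_(f : {ffun 'I_d -> 'I_n})
      (~~ [forall k, B (f k)])%:R * \det (rowsub f X) ^+ 2.
  rewrite mulrnBl !det_weighted_gram -sumrB; apply: eq_bigr => f _.
  rewrite prod1 prod_ind -mulrBl; congr (_ * _).
  by case: [forall k, B (f k)]; rewrite ?subrr ?subr0.
rewrite -(ler_pMn2r (fact_gt0 d)) -sumrMnl detB.
under [leRHS]eq_bigr => i _ do rewrite detB.
rewrite exchange_big; apply: ler_sum => f _ /=.
rewrite -mulr_suml ler_wpM2r ?sqr_ge0 //.
(* If [f] leaves [A] at [k], the summand [i = f k] on the right already counts it. *)
have [|/existsP[k nAfk]] := boolP [forall k, A (f k)]; first by rewrite sumr_ge0.
rewrite (bigD1 (f k)) //= ler_wpDr ?sumr_ge0 //.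
have -> // : ~~ [forall k', predC1 (f k) (f k')].
by rewrite negb_forall; apply/existsP; exists k; rewrite /= eqxx.
Qed.

(** Sylvester's identity, from two triangular factorisations of the block matrix with unit diagonal
    blocks and off-diagonal blocks [U], [V]. *)
Lemma det_1_sub_mulC (R : comPzRingType) (m n : nat) (U : 'M[R]_(m, n))
    (V : 'M[R]_(n, m)) :
  \det (1%:M - U *m V) = \det (1%:M - V *m U).
Proof.
have e1 : block_mx 1%:M U V 1%:M =
    block_mx (1%:M - U *m V) U 0 1%:M *m block_mx 1%:M 0 V 1%:M.
  rewrite mulmx_block !mulmx1 !mul1mx !mul0mx ?mulmx0 !add0r.
  by rewrite subrK.
have e2 : block_mx 1%:M U V 1%:M =
    block_mx 1%:M 0 V 1%:M *m block_mx 1%:M U 0 (1%:M - V *m U).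
  rewrite mulmx_block !mulmx1 !mul1mx !mul0mx ?mulmx0 !addr0.
  by rewrite addrC subrK.
have := congr1 determinant (etrans (esym e1) e2).
by rewrite !det_mulmx !det_lblock !det_ublock !det1 !mulr1 !mul1r.
Qed.

Lemma weighted_gram_const (R : comPzRingType) (n d : nat) (X : 'M[R]_(n, d)) :
  weighted_gram X (const_mx 1) = X^T *m X.
Proof. by rewrite /weighted_gram diag_const_mx mulmx1. Qed.

Lemma leverageE (R : realType) (n d : nat) (X : 'M[R]_(n, d)) (i : 'I_n) :
  leverage X i = (X *m invmx (X^T *m X) *m X^T) i i.
Proof.
rewrite /leverage /= -colE trmx_delta -!mulmxA -rowE !mulmxA.
by rewrite !mxE.
Qed.

(** The scores are the diagonal of the hat matrix, whose trace is that of the identity of size [d]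
    by cyclicity. *)
Lemma sum_leverage (R : realType) (n d : nat) (X : 'M[R]_(n, d)) :
  X^T *m X \in unitmx -> \sum_i leverage X i = d%:R.
Proof.
move=> uA; rewrite (eq_bigr _ (fun i _ => leverageE X i)) -/(mxtrace _).
by rewrite -mulmxA mxtrace_mulC -mulmxA mulVmx // mxtrace1.
Qed.

Lemma det_gram_remove_row (R : realType) (n d : nat) (X : 'M[R]_(n, d))
    (i : 'I_n) :
  X^T *m X \in unitmx ->
  \det (weighted_gram X (indicator_row R (predC1 i))) =
    \det (X^T *m X) * (1 - leverage X i).
Proof.
move=> uA; set A := X^T *m X; set x := row i X.
(* Deletion is the rank-one downdate [A - x^T x]; with [A] factored out, Sylvester's identity leaves
   the scalar [1 - x A^-1 x^T]. *)
have -> : weighted_gram X (indicator_row R (predC1 i)) =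
    A *m (1%:M - invmx A *m x^T *m x).
  rewrite mulmxBr mulmx1 !mulmxA mulmxV // mul1mx /A -weighted_gram_const.
  rewrite !weighted_gramE (bigD1 i) //= [in RHS](bigD1 i) //= !mxE /= eqxx.
  rewrite scale0r scale1r add0r [RHS]addrC addKr.
  by apply: eq_bigr => j ne_ji; rewrite !mxE /= ne_ji.
rewrite det_mulmx det_1_sub_mulC det_mx11 !mxE leverageE; congr (_ * (_ - _)).
rewrite -mulmxA [in RHS]mxE; apply: eq_bigr => j _.
by rewrite [x 0 j]mxE /x tr_row colE mulmxA -colE [col _ _ _ _]mxE.
Qed.

Lemma det_first_rows_gt (R : realType) (n d s : nat) (hs : (s <= n)%N)
    (X : 'M[R]_(n, d)) (eps : R) :
  \rank X = d -> d%:R - eps < leverage_sum X s ->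
  (1 - eps) * \det (X^T *m X)
    < \det (weighted_gram (first_rows hs X) (const_mx 1)).
Proof.
move=> rankX lt_sum.
have detA_gt0 : 0 < \det (X^T *m X).
  by rewrite -weighted_gram_const det_gram_gt0.
have uA : X^T *m X \in unitmx by rewrite unitmxE unitfE gt_eqF.
have -> : weighted_gram (first_rows hs X) (const_mx 1) =
    weighted_gram X (indicator_row R (fun i : 'I_n => (i < s)%N)).
  rewrite weighted_gram_const weighted_gramE.
  apply/matrixP=> a b; rewrite !mxE summxE.
  pose F (i : 'I_n) := X i a * X i b.
  rewrite (eq_bigr (fun i => F (widen_ord hs i))); last first.
    by move=> i _; rewrite !mxE.
  rewrite -(big_ord_narrow (F := F) hs) big_mkcond /=; apply: eq_bigr => i _.
  rewrite !mxE big_ord1 !mxE; case: ifP => _; first by rewrite mul1r.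
  by rewrite mul0r.
have := det_gram_union_bound X (fun i : 'I_n => (i < s)%N).
rewrite weighted_gram_const.
under eq_bigr => i _ do rewrite det_gram_remove_row // mulrBr mulr1 subKr.
rewrite -mulr_sumr lerBlDr -lerBlDl; apply: lt_le_trans.
(* The total [d] splits into kept and missed scores; the kept ones exceed [d - eps], so the missed
   ones sum to less than [eps]. *)
have := sum_leverage uA.
rewrite (bigID (fun i : 'I_n => (i < s)%N)) /= -/(leverage_sum X s) => sumE.
rewrite mulrC -[X in _ < X - _]mulr1 -mulrBr ltr_pM2l // ltrD2l ltrN2.
by move: lt_sum; rewrite -sumE ltrBlDr ltrD2l.
Qed.

Lemma dual_optimum_le (R : realType) (n d : nat) (X : 'M[R]_(n, d)) :
  \rank X = d -> (dual_optimum X <= (ln (\det (X^T *m X)))%:E)%E.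
Proof.
move=> rankX; apply: ge_ereal_sup => _ [u [u_ge0 sum_u] <-].
have -> : dual_objective X u = lne (\det (weighted_gram X u^T))%:E.
  rewrite /dual_objective weighted_gramE; congr (lne (\det _)%:E).
  by apply: eq_bigr => i _; rewrite [u^T _ _]mxE.
rewrite -weighted_gram_const.
have le_det : \det (weighted_gram X u^T) <= \det (weighted_gram X (const_mx 1)).
  apply: det_weighted_gram_le => i; rewrite !mxE u_ge0 -sum_u /=.
  by rewrite (bigD1 i) //= lerDl sumr_ge0.
(* When the determinant is not positive, [lne] is -oo and the bound is trivial; otherwise [ln] is
   monotone. *)
have [det_le0|det_gt0] := leP (\det (weighted_gram X u^T)) 0.
  by rewrite le0_lneNy ?leNye // lee_fin.
by rewrite lne_EFin // lee_fin ler_ln // posrE det_gram_gt0.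
Qed.

Theorem theorem5p1 (R : realType) (n d : nat) (X : 'M[R]_(n, d)) (eps : R)
    (s : nat) (hs : (s <= n)%N)
    (d_gt0 : (0 < d)%N) (d_lt_n : (d < n)%N) (rankX : \rank X = d)
    (sortedX : forall i j : 'I_n, (i <= j)%N -> leverage X j <= leverage X i)
    (eps_gt0 : 0 < eps) (eps_lt1 : eps < 1)
    (s_min : is_threshold X eps s) :
  let Xs := first_rows hs X in
  let u0 : 'cV[R]_s := const_mx (1 / s%:R) in
  (dual_optimum X - sampled_objective Xs u0
     < (d%:R * ln (s%:R / (1 - eps)))%:E)%E.
Proof.
cbv zeta; set Xs := first_rows hs X; set u0 := const_mx _.
case: s_min => /andP[s_gt0 _] lt_sum _.
have detA_gt0 : 0 < \det (X^T *m X).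
  by rewrite -weighted_gram_const det_gram_gt0.
have eps1_gt0 : 0 < 1 - eps by rewrite subr_gt0.
have sR_gt0 : 0 < s%:R :> R by rewrite ltr0n.
have lt_det := det_first_rows_gt hs rankX lt_sum.
rewrite -/Xs in lt_det; set Ds := \det (weighted_gram _ _) in lt_det.
have Ds_gt0 : 0 < Ds by apply: lt_trans lt_det; rewrite mulr_gt0.
(* Uniform weights scale the sampled Gram matrix by [1/s], hence its determinant by [s^-d]; this is
   the source of the term [d ln s]. *)
have detu0 : \det (Xs^T *m diag_mx u0^T *m Xs) = s%:R^-1 ^+ d * Ds.
  rewrite /Ds weighted_gram_const -detZ trmx_const diag_const_mx div1r.
  by rewrite mul_mx_scalar -scalemxAl.
have -> : sampled_objective Xs u0 = (ln Ds - d%:R * ln s%:R)%:E.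
  have V_gt0 : 0 < s%:R^-1 ^+ d :> R by rewrite exprn_gt0 ?invr_gt0.
  rewrite /sampled_objective detu0 lne_EFin ?mulr_gt0 // lnM ?posrE //.
  by rewrite lnXn ?invr_gt0 // lnV ?posrE // mulNrn addrC mulr_natl.
apply: (@le_lt_trans _ _ ((ln (\det (X^T *m X)))%:E -
    (ln Ds - d%:R * ln s%:R)%:E)%E).
  by rewrite leeB // dual_optimum_le.
rewrite -EFinB lte_fin ln_div ?posrE // mulrBr opprB addrC -addrA ltrD2l.
(* After [d ln s] cancels, the determinant estimate bounds the rest strictly by [- ln (1 - eps)].
   This is nonnegative and [d >= 1], so it is at most [d] times itself. *)
have ln_eps_le0 : ln (1 - eps) <= 0 by rewrite ln_le0 // lerBlDr lerDl ltW.
apply: (@lt_le_trans _ _ (- ln (1 - eps))).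
  rewrite addrC ltrBlDr addrC -ltrBlDr opprK -lnM ?posrE //.
  by rewrite ltr_ln ?posrE ?mulr_gt0 // mulrC.
by rewrite lerN2 mulr_natl -[leRHS]mulr1n ler_wnMn2l.
Qed.
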